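(* Let $r\ge 2$ and $k\ge 2$. Let $\mathcal{H}$ be a family of $k$-graphs and let $F$ be a $(k-1)$-graph such that for all $H\in \mathcal{H}$ the link graph of every vertex in $H$ contains a copy of $F$. Then \[\hat{R}_r(\mathcal{H})\geq \frac{1}{k}\,\hat{R}_r(F)\cdot R_r(\mathcal{H}).\]
   Context: A $k$-graph is a $k$-uniform hypergraph. For a $k$-graph $H$ and $v\in V(H)$, the link graph of $v$ in $H$ is the $(k-1)$-graph on $V(H)$ whose edges are the $(k-1)$-sets $e$ with $e\cup\{v\}\in E(H)$. For a $k$-graph $G$ and a family $\mathcal{H}$ of $k$-graphs, $G\to_r\mathcal{H}$ means every $r$-coloring of the edges of $G$ contains a monochromatic copy of some member of $\mathcal{H}$; $\hat R_r(\mathcal{H})$ (resp. $R_r(\mathcal{H})$) is the minimum number of edges (resp. vertices) of a $k$-graph $G$ with $G\to_r\mathcal{H}$. For a single hypergraph $F$, $\hat R_r(F)=\hat R_r(\{F\})$. *)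

(* Defs.v *)
From HB Require Import structures.
From mathcomp Require Import all_boot all_order all_algebra.
From mathcomp Require Import all_classical all_reals ereal.

Set Implicit Arguments.
Unset Strict Implicit.
Unset Printing Implicit Defensive.

Import Order.TTheory GRing.Theory Num.Theory.

Record kgraph (k : nat) := KGraph {
  vertex :> finType;
  edges : {set {set vertex}};
  edges_uniform : forall e, e \in edges -> #|e| = k
}.

(* [set (kgraph k)] would be a universe inconsistency, hence bare predicates
   for families of k-graphs. *)
Definition kfamily (k : nat) := kgraph k -> Prop.

Definition single (k : nat) (F : kgraph k) : kfamily k := fun H => H = F.

(* [f] exhibits a (not necessarily induced) copy of [H] in [G]; isolated
   vertices of [H] must be mapped injectively as well. *)
Definition copy (k : nat) (H G : kgraph k) (f : H -> G) : Prop :=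
  injective f /\ forall e, e \in edges H -> f @: e \in edges G.

Definition contains_copy (k : nat) (G H : kgraph k) : Prop :=
  exists f : H -> G, copy f.

Definition link_edges (k : nat) (H : kgraph k) (v : H) : {set {set H}} :=
  [set e : {set H} | (#|e| == k.-1) && (v |: e \in edges H)].

Lemma link_uniform (k : nat) (H : kgraph k) (v : H) (e : {set H}) :
  e \in link_edges v -> #|e| = k.-1.
Proof. by rewrite inE => /andP[/eqP]. Qed.

Definition link (k : nat) (H : kgraph k) (v : H) : kgraph k.-1 :=
  KGraph (@link_uniform k H v).

(* A colouring is given on all vertex sets, but only its values on the edges
   of [G] are ever used. *)
Definition arrows (r k : nat) (G : kgraph k) (HH : kfamily k) : Prop :=
  forall c : {set G} -> 'I_r,
  exists2 H : kgraph k, HH H &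
  exists (f : H -> G) (i : 'I_r),
    copy f /\ forall e, e \in edges H -> c (f @: e) = i.

Local Open Scope classical_set_scope.

(* The minimum of a set of naturals, with value +oo on the empty set. *)
Definition minimum (R : realType) (A : set nat) : \bar R :=
  ereal_inf [set (n%:R)%R%:E | n in A].

Lemma minimum0 (R : realType) : minimum R set0 = +oo%E.
Proof. by rewrite /minimum image_set0 ereal_inf0. Qed.

Lemma minimumE (R : realType) (A : set nat) (m : nat) :
  A m -> (forall n, A n -> m <= n) -> minimum R A = (m%:R)%R%:E.
Proof.
move=> Am Amin; apply/eqP; rewrite eq_le; apply/andP; split.
  by apply: ereal_inf_lbound; exists m.
by apply: le_ereal_inf_tmp => _ [n An <-]; rewrite lee_fin ler_nat Amin.
Qed.

Definition size_ramsey (R : realType) (r k : nat) (HH : kfamily k) :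
    \bar R :=
  minimum R [set n | exists2 G : kgraph k, arrows r G HH & n = #|edges G|].

Definition ramsey (R : realType) (r k : nat) (HH : kfamily k) : \bar R :=
  minimum R [set n | exists2 G : kgraph k, arrows r G HH & n = #|G|].

(* Main.v *)
(** Let [G] arrow [HH] and let [U] be the set of vertices of [G] whose link
    arrows [F].  The complete [k]-graph on [U] still arrows [HH]: a colouring of
    it extends to [G] by colouring an edge meeting the complement of [U]
    according to an [F]-free colouring of the link of its first vertex [v]
    outside [U].  A monochromatic copy of some [H] in [G] must then lie in [U],
    since otherwise the edges of the copy at its first vertex outside [U] would
    provide a monochromatic copy of [F] in the link of that vertex.  Hence
    [#|U|] is at least the Ramsey number of [HH]; each vertex of [U] has degree
    at least the size Ramsey number of [F], and the degrees add up to [k] times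
    the number of edges. *)
Require Import Defs.
From HB Require Import structures.
From mathcomp Require Import all_boot all_order all_algebra.
From mathcomp Require Import all_classical all_reals ereal.

Set Implicit Arguments.
Unset Strict Implicit.
Unset Printing Implicit Defensive.

Import Order.TTheory GRing.Theory Num.Theory.

Section Minimum.
Variable R : realType.

Lemma minimum_ge0 (A : set nat) : (0 <= minimum R A)%E.
Proof. by apply: le_ereal_inf_tmp => _ [n _ <-]; rewrite lee_fin ler0n. Qed.

Lemma minimum_le (A : set nat) n : A n -> (minimum R A <= n%:R%:E)%E.
Proof. by move=> An; apply: ereal_inf_lbound; exists n. Qed.

End Minimum.

Section CompleteGraph.
Variables (k : nat) (T : finType).

Lemma complete_uniform (e : {set T}) : e \in [set e : {set T} | #|e| == k] -> #|e| = k.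
Proof. by rewrite inE => /eqP. Qed.

Definition complete : kgraph k := KGraph complete_uniform.

End CompleteGraph.

Section Degree.
Variables (k : nat) (k_gt0 : 0 < k) (G : kgraph k).

(** Otherwise [v |: e] equals [e], whose cardinality would be both [k.-1] and [k]. *)
Lemma link_notin (v : G) e : e \in edges (link v) -> v \notin e.
Proof.
rewrite inE => /andP[/eqP ce /edges_uniform cve]; apply/negP => ve.
have vUe : v |: e = e by apply/finset.setUidPr; rewrite finset.sub1set.
by move: cve; rewrite vUe ce => kE; have := ltn_predL k; rewrite k_gt0 kE ltnn.
Qed.

(** Adding [v] is injective on link edges, since removing [v] undoes it. *)
Lemma card_link_le (v : G) :
  #|edges (link v)| <= #|[set e in edges G | v \in e]|.
Proof.
rewrite -(@card_in_imset _ _ (fun e => v |: e)) => [|e1 e2 h1 h2 eq12].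
  apply/subset_leq_card/fintype.subsetP => _ /imsetP[e + ->].
  by rewrite !inE eqxx => /andP[_ ->].
by rewrite -(finset.setU1K (link_notin h1)) eq12 finset.setU1K ?link_notin.
Qed.

Lemma sum_card_link_le : \sum_(v : G) #|edges (link v)| <= k * #|edges G|.
Proof.
apply: (@leq_trans (\sum_(v : G) #|[set e in edges G | v \in e]|)).
  by apply: leq_sum => v _; exact: card_link_le.
(* Double counting of incidences: after the exchange each edge contributes its [k] vertices. *)
under eq_bigr do rewrite -sum1dep_card big_mkcondr.
rewrite exchange_big /= mulnC -sum_nat_const.
apply: leq_sum => e /edges_uniform ce.
by rewrite -big_mkcond sum1_card ce.
Qed.

End Degree.

Section FirstIn.
Variable T : finType.

Definition first_in (A : {set T}) : option T :=
  [pick v in A | [forall w in A, enum_rank v <= enum_rank w]].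

Lemma first_inP (A : {set T}) (v : T) :
  reflect (v \in A /\ forall w, w \in A -> enum_rank v <= enum_rank w)
          (first_in A == Some v).
Proof.
rewrite /first_in; case: pickP => [u /andP[uA /forall_inP umin]|none].
  apply: (iffP eqP) => [[<-] //|[vA vmin]]; congr Some; apply: enum_rank_inj.
  by apply/val_inj/eqP; rewrite eqn_leq umin ?vmin.
apply: (iffP eqP) => // -[vA vmin]; have /negP[] := negbT (none v).
by rewrite vA; apply/forall_inP.
Qed.

Lemma first_in_ex (A : {set T}) (u : T) :
  u \in A -> exists v, first_in A = Some v.
Proof.
move=> uA; case: (arg_minnP (fun w => val (enum_rank w)) uA) => v vA vmin.
by exists v; apply/eqP/first_inP.
Qed.

(** Serves to pass from a whole copy to its edges: an edge through the first outside vertex of the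
    copy has that same first outside vertex. *)
Lemma first_in_sub (A B : {set T}) (v : T) :
  B \subset A -> v \in B -> first_in A = Some v -> first_in B = Some v.
Proof.
move=> /fintype.subsetP BA vB /eqP/first_inP[_ vmin].
by apply/eqP/first_inP; split=> // w /BA/vmin.
Qed.

End FirstIn.

Section Arrows.
Variables (r k : nat) (k_gt0 : 0 < k) (HH : kfamily k) (F : kgraph k.-1).
Hypothesis hlink : forall H, HH H -> forall v : H, contains_copy (link v) F.

Definition arrowing_vertices (G : kgraph k) : {set G} :=
  [set v : G | `[< arrows r (link v) (single F) >]].

Lemma not_arrowing_colouring (G : kgraph k) (v : G) :
  v \notin arrowing_vertices G -> exists c : {set G} -> 'I_r,
    forall (f : F -> link v) i,
      copy f -> ~ forall e, e \in edges F -> c (f @: e) = i.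
Proof.
rewrite inE => /asboolPn; rewrite /arrows => /existsNP[c nc].
exists c => f i fc fi; apply: nc; exists F => //.
by exists f, i.
Qed.

Lemma arrows_complete (G : kgraph k) :
  arrows r G HH ->
  arrows r (complete k {v : G | v \in arrowing_vertices G}) HH.
Proof.
set U := arrowing_vertices G => GH c.
have /choice[col colP] (v : G) : exists cv : {set G} -> 'I_r, v \notin U ->
    forall (f : F -> link v) i,
      copy f -> ~ forall e, e \in edges F -> cv (f @: e) = i.
  have [vU|/not_arrowing_colouring[cv cvP]] := boolP (v \in U).
    (* A dummy colouring, as [c'] below consults [col v] only for [v] outside [U]; [c] supplies the
       element of ['I_r]. *)
    by exists (fun=> c finset.set0).
  by exists cv.
pose c' (e : {set G}) := if first_in (e :\: U) is Some v then col v (e :\ v)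
  else c [set u | val u \in e].
have [H HHH [f [i [[f_inj fE] fi]]]] := GH c'.
have fU x : f x \in U.
  apply/negPn/negP => fxU.
  (* [w] is first in the image of all of [H], so every edge of the copy through [w] gets its colour
     from the same [col w]. *)
  have [|w wfirst] := @first_in_ex _ ([set f x | x in H] :\: U) (f x).
    by rewrite inE fxU imset_f.
  have /eqP/first_inP[/setDP[/imsetP[v _ w_eq] wU] _] := wfirst.
  have [g [g_inj gE]] := hlink HHH v.
  have vgE e : e \in edges F -> v |: g @: e \in edges H.
    by move=> /gE; rewrite inE => /andP[].
  have fvgE (e : {set F}) : f @: (v |: g @: e) = w |: (f \o g) @: e.
    by rewrite imsetU1 w_eq (imset_comp f g).
  have fgE e : e \in edges F -> (f \o g) @: e \in edges (link w).
    move=> eF; rewrite inE -fvgE fE ?vgE // andbT card_imset; last exact: inj_comp.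
    by rewrite (edges_uniform eF).
  apply: (colP w wU (f \o g) i); first by split; [exact: inj_comp|exact: fgE].
  move=> e eF; rewrite -(fi _ (vgE e eF)) fvgE /c'.
  rewrite (first_in_sub _ _ wfirst).
  - by rewrite finset.setU1K // (link_notin k_gt0) // fgE.
  - by rewrite finset.setSD // -fvgE imsetS //; apply/fintype.subsetP.
  - by rewrite finset.in_setD wU finset.setU11.
pose h x : {v : G | v \in U} := exist _ (f x) (fU x).
have h_inj : injective h by move=> x y /(congr1 val) /f_inj.
exists H => //; exists h, i; split.
  split=> // e eH; rewrite inE card_imset //.
  by rewrite (edges_uniform eH).
move=> e eH; rewrite -(fi _ eH) /c'.
(* The copy lies in [U], so [c'] takes its second branch: [c] on the edge pulled back to [U]. *)
have -> : f @: e :\: U = finset.set0.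
  by apply/eqP; rewrite finset.setD_eq0; apply/fintype.subsetP => _ /imsetP[x _ ->].
have -> : first_in (@finset.set0 G) = None.
  by rewrite /first_in; case: pickP => // u; rewrite inE.
congr c; apply/setP => u; rewrite inE.
have -> : f @: e = val @: (h @: e) by rewrite -(imset_comp val h).
by rewrite mem_imset //; exact: val_inj.
Qed.

End Arrows.

Theorem theorem5p2 (R : realType) (r k : nat) (hr : 2 <= r) (hk : 2 <= k)
    (HH : kfamily k) (F : kgraph k.-1)
    (hlink : forall H : kgraph k, HH H ->
       forall v : H, contains_copy (link v) F) :
  (size_ramsey R r HH >=
     (1 / k%:R)%R%:E * size_ramsey R r (single F) * ramsey R r HH)%E.
Proof.
have k_gt0 : 0 < k by exact: ltnW.
apply: le_ereal_inf_tmp => _ [_ [G GH ->] <-].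
set U := arrowing_vertices r F G.
have ramseyU : (ramsey R r HH <= #|U|%:R%:E)%E.
  apply: minimum_le.
  exists (complete k {v : G | v \in U}); first exact: arrows_complete.
  by rewrite /= card_sig.
have sizeF v : v \in U ->
    (size_ramsey R r (single F) <= #|edges (link v)|%:R%:E)%E.
  by rewrite inE => /asboolP ?; apply: minimum_le; exists (link v).
have ramsey_ge0 : (0 <= ramsey R r HH)%E by exact: minimum_ge0.
have size_ge0 : (0 <= size_ramsey R r (single F))%E by exact: minimum_ge0.
(* If [U] is empty, the Ramsey number is 0 and the product vanishes even if the other factor is
   infinite. *)
have [U0|[u uU]] := set_0Vmem U.
  have -> : ramsey R r HH = 0%E.
    by apply/eqP; rewrite eq_le ramsey_ge0 andbT; rewrite U0 cards0 in ramseyU.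
  by rewrite mule0 lee_fin ler0n.
(* The degree of [u] is a finite upper bound, so the size Ramsey number of [F] is a real [s]. *)
move: size_ge0 sizeF; case: (size_ramsey R r (single F)) => [s||] //; last first.
  by move=> _ /(_ _ uU); rewrite leye_eq.
rewrite lee_fin => s_ge0 sizeF.
apply: (@le_trans _ _ ((1 / k%:R * s)%R%:E * #|U|%:R%:E)%E).
  rewrite -EFinM; apply: lee_wpmul2l => //.
  by rewrite lee_fin mulr_ge0 // divr_ge0.
rewrite -EFinM lee_fin mul1r -mulrA ler_pdivrMl ?ltr0n //.
rewrite -natrM mulr_natr -sumr_const.
apply: (@le_trans _ _ (\sum_(v in U) #|edges (link v)|%:R)%R).
  by apply: ler_sum => v /sizeF; rewrite lee_fin.
rewrite -natr_sum ler_nat; apply: leq_trans (sum_card_link_le k_gt0 G).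
(* Vertices outside [U] only add to the degree sum. *)
by rewrite [leqRHS](bigID (mem U)) leq_addr.
Qed.
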